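(* Let $G$ be a finite undirected graph, let $k\ge 0$, $m$ and $c\ge 1$ be integers with $1\le m\le 2k+1$. If $\mathrm{wcol}_m(G)\le c$, then $\mathrm{dom}_k(G)\le c^2\,\alpha_m(G)$. Furthermore, if an ordering of $V(G)$ such that $q_m(v)<c$ for every $v\in V(G)$ is given, then a $k$-dominating set $D$ and an $m$-independent set $A$ of $G$ with $|D|\le c^2|A|$ can be found in $O(c^2\max(k,m)\,|V(G)|)$ time.
   Context: A set $D\subseteq V(G)$ is $k$-dominating if every vertex of $G$ is at distance at most $k$ from some vertex of $D$; $\mathrm{dom}_k(G)$ is the minimum size of a $k$-dominating set. A set $A\subseteq V(G)$ is $d$-independent if the distance in $G$ between every two distinct vertices of $A$ is greater than $d$; $\alpha_d(G)$ is the maximum size of a $d$-independent set. For an ordering $v_1,\dots,v_n$ of $V(G)$, a vertex $v_a$ is weakly $k$-accessible from $v_b$ if $a<b$ and there is a path $v_a=v_{i_0},v_{i_1},\dots,v_{i_\ell}=v_b$ in $G$ of length $\ell\le k$ with $a\le i_j$ for all $0\le j\le \ell$. Let $Q_k(v)$ be the set of vertices weakly $k$-accessible from $v$ and $q_k(v)=|Q_k(v)|$. The weak $k$-coloring number of the ordering is $\max_{v\in V(G)}(1+q_k(v))$, and $\mathrm{wcol}_k(G)$ is the minimum of this over all orderings of $V(G)$. *)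

(* Defs.v *)
From mathcomp Require Import all_boot.

Set Implicit Arguments.
Unset Strict Implicit.
Unset Printing Implicit Defensive.

Section Graph.

Variables (T : finType) (e : rel T).

(* [path] of the library describes walks; [uniq] turns the walk u :: p into a
   path in the graph-theoretic sense, of length [size p]. *)
Definition joins (u v : T) (p : seq T) : bool :=
  [&& path e u p, uniq (u :: p) & last u p == v].

(* The distance of vertices in different components is infinite, so that
   [dist_le d u v] is then false for all d. *)
Definition dist_le (d : nat) (u v : T) : bool :=
  [exists l : 'I_d.+1, exists p : l.-tuple T, joins u v p].

Definition dominating (k : nat) (D : {set T}) : bool :=
  [forall v, exists u in D, dist_le k v u].

Definition dom (k : nat) : nat :=
  #|[arg min_(D < [set: T] | dominating k D) #|D|]|.

Definition independent (d : nat) (A : {set T}) : bool :=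
  [forall u in A, forall v in A, (u != v) ==> ~~ dist_le d u v].

Definition alpha (d : nat) : nat :=
  \max_(A : {set T} | independent d A) #|A|.

(* An ordering of the vertices is a duplicate-free #|T|-tuple s, and the
   position of v in it is [index v s]. *)

Definition weakly_accessible (s : #|T|.-tuple T) (k : nat) (a b : T) : bool :=
  (index a s < index b s) &&
  [exists l : 'I_k.+1, exists p : l.-tuple T,
     joins a b p && all (fun x => index a s <= index x s) (a :: p)].

Definition Q (s : #|T|.-tuple T) (k : nat) (v : T) : {set T} :=
  [set u | weakly_accessible s k u v].

Definition q (s : #|T|.-tuple T) (k : nat) (v : T) : nat := #|Q s k v|.

Definition wcol_of (s : #|T|.-tuple T) (k : nat) : nat := \max_v (1 + q s k v).

Definition wcol (k : nat) : nat :=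
  wcol_of [arg min_(s < enum_tuple T | uniq s) wcol_of s k] k.

End Graph.

(* Running times are measured on a unit-cost random access machine: registers
   and memory cells hold natural numbers, and the only arithmetic operations are
   addition and truncated subtraction. The memory is divided into banks. The
   bank of an access is fixed in the program text, so a program uses finitely
   many banks; the address within the bank is computed. *)

Record state := State { reg : nat -> nat; cell : nat -> nat -> nat }.

Inductive expr :=
| EConst (n : nat)
| EReg (r : nat)
| EAdd (a b : expr)
| ESub (a b : expr)
| ELoad (bank : nat) (addr : expr).

Inductive cmd :=
| CSkip
| CAssign (r : nat) (a : expr)
| CStore (bank : nat) (addr a : expr)
| CSeq (c1 c2 : cmd)
| CIf (a : expr) (c1 c2 : cmd)
| CWhile (a : expr) (c : cmd).

Fixpoint eval (st : state) (a : expr) : nat :=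
  match a with
  | EConst n => n
  | EReg r => reg st r
  | EAdd a b => eval st a + eval st b
  | ESub a b => eval st a - eval st b
  | ELoad b i => cell st b (eval st i)
  end.

Fixpoint ecost (a : expr) : nat :=
  match a with
  | EConst _ | EReg _ => 1
  | EAdd a b | ESub a b => (ecost a + ecost b).+1
  | ELoad _ i => (ecost i).+1
  end.

Definition set_reg (st : state) (r x : nat) : state :=
  State (fun r' => if r' == r then x else reg st r') (cell st).

Definition set_mem (st : state) (b i x : nat) : state :=
  State (reg st)
    (fun b' i' => if (b' == b) && (i' == i) then x else cell st b' i').

(* [exec c st st' t]: started in st, c halts in st' after t steps. A test
   succeeds when its value is nonzero. *)
Inductive exec : cmd -> state -> state -> nat -> Prop :=
| exec_skip st :
    exec CSkip st st 1
| exec_assign st r a :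
    exec (CAssign r a) st (set_reg st r (eval st a)) (ecost a).+1
| exec_store st b i a :
    exec (CStore b i a) st (set_mem st b (eval st i) (eval st a))
      (ecost i + ecost a).+1
| exec_seq c1 c2 st1 st2 st3 t1 t2 :
    exec c1 st1 st2 t1 -> exec c2 st2 st3 t2 ->
    exec (CSeq c1 c2) st1 st3 (t1 + t2)
| exec_if_true a c1 c2 st st' t :
    eval st a != 0 -> exec c1 st st' t ->
    exec (CIf a c1 c2) st st' (ecost a + t).+1
| exec_if_false a c1 c2 st st' t :
    eval st a = 0 -> exec c2 st st' t ->
    exec (CIf a c1 c2) st st' (ecost a + t).+1
| exec_while_false a c st :
    eval st a = 0 ->
    exec (CWhile a c) st st (ecost a).+1
| exec_while_true a c st1 st2 st3 t1 t2 :
    eval st1 a != 0 -> exec c st1 st2 t1 -> exec (CWhile a c) st2 st3 t2 ->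
    exec (CWhile a c) st1 st3 (ecost a + t1 + t2).+1.

Section InputOutput.

Variables (T : finType) (e : rel T).

(* The lists may enumerate the neighbours in any order. *)
Definition adjacency_lists (adj : T -> seq T) : Prop :=
  forall v, uniq (adj v) /\ adj v =i e v.

(* The vertex v is represented by the number [enum_rank v] < #|T|.
   Registers 0, 1, 2, 3: the number of vertices, k, m, c.
   Bank 0: the ordering s.
   Bank 2: the concatenation of the adjacency lists of vertices 0, 1, ...
   Bank 1: the list of vertex i occupies the addresses from the i-th entry of
   this bank (inclusive) to the (i+1)-st one (exclusive) of bank 2.
   All other registers and cells are zero. *)
Definition input (adj : T -> seq T) (s : #|T|.-tuple T) (k m c : nat) : state :=
  let code := map (fun v : T => nat_of_ord (enum_rank v)) in
  let lists := [seq code (adj v) | v <- enum T] in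
  let offsets := [seq sumn (take i (shape lists)) | i <- iota 0 #|T|.+1] in
  State (nth 0 [:: #|T|; k; m; c])
        (fun b => nth 0 (nth [::] [:: code s; offsets; flatten lists] b)).

Definition output (bank : nat) (st : state) : {set T} :=
  [set v : T | cell st bank (enum_rank v) != 0].

End InputOutput.

(* Main.v *)
(* For every vertex v consider the vertices z, at most c of them, that reach v
   by a walk of length at most m on which z comes first in the ordering. Treat the
   vertices in order: if some already claimed z reaches v within k steps in this
   way, then z dominates v and v is skipped; otherwise v becomes a centre and
   claims every unclaimed z that reaches it. The claimed vertices form D, so |D|
   is at most c times the number of centres. If two centres a < b are at distance
   at most m <= 2k+1, the first vertex z of a shortest path reaches both, one of
   them within k steps; it must be a, as b was not skipped, and so a claimed z.
   Going through the centres from the last to the first, keeping each centre not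
   yet discarded and discarding the claimants of the at most c vertices reaching
   it, gives an m-independent set with at least a fraction 1/c of the centres.

   The pairs (z, v) come from one search per source z, from the last to the first,
   in which a vertex is rescanned whenever its distance from z drops. This happens
   at most m + 1 times per pair, and there are at most c n pairs and c n edges. *)
From mathcomp Require Import all_boot zify.
Require Import Defs.

Set Implicit Arguments.
Unset Strict Implicit.
Unset Printing Implicit Defensive.

(** * Weak accessibility along walks *)

Section Reach.

Variables (T : finType) (e : rel T) (s : #|T|.-tuple T).
Hypotheses (esym : symmetric e) (us : uniq s).

Let pos v := index v s.

(** Walks replace paths and z = v is allowed, so that appending an edge needs no check of
    distinctness. *)
Definition wreach (l : nat) (z v : T) : Prop :=
  exists p, [/\ path e z p, last z p = v, size p <= l &
                all (fun x => index z s <= index x s) p].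

Lemma ordering_mem v : v \in s.
Proof.
have [|| _ ->] := @uniq_min_size _ s (enum T) us; last by rewrite mem_enum.
- by move=> x _; rewrite mem_enum.
- by rewrite -cardE size_tuple.
Qed.

Lemma pos_lt v : pos v < #|T|.
Proof. by have := ordering_mem v; rewrite -index_mem size_tuple. Qed.

Lemma pos_inj : injective pos.
Proof.
move=> x y h.
by rewrite -(nth_index x (ordering_mem x)) -/(pos x) h (nth_index x (ordering_mem y)).
Qed.

Lemma pos_surj i : i < #|T| -> exists v, pos v = i.
Proof.
case: (pickP T) => [x _|T0] lt_i.
  by exists (nth x s i); apply: index_uniq; rewrite ?size_tuple.
by have := lt_i; rewrite (eq_card0 T0).
Qed.

Lemma wreach_pos l z v : wreach l z v -> pos z <= pos v.
Proof.
case=> p [_ <- _ /allP h].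
by have := mem_last z p; rewrite inE => /predU1P[->|/h].
Qed.

Lemma wreach_refl l z : wreach l z z.
Proof. by exists [::]. Qed.

Lemma wreachW l l' z v : l <= l' -> wreach l z v -> wreach l' z v.
Proof. by move=> h [p [? ? ? ?]]; exists p; split=> //; apply: leq_trans h. Qed.

Lemma wreach_step l z v w :
  wreach l z v -> e v w -> pos z <= pos w -> wreach l.+1 z w.
Proof.
case=> p [pp <- sp ap] evw zw; exists (rcons p w).
by rewrite rcons_path pp last_rcons size_rcons all_rcons; split=> //; apply/andP.
Qed.

Lemma walk_joins u v p d :
  path e u p -> last u p = v -> size p <= d ->
  exists2 q : seq T, joins e u v q & size q <= d /\ {subset q <= p}.
Proof.
move=> pp lp sp.
case: (shortenP pp) lp => q pq uq sqp lq.
exists q; first by rewrite /joins pq uq lq eqxx.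
split=> //; apply: leq_trans sp.
by case/andP: uq => _ uq; apply: uniq_leq_size.
Qed.

Lemma ex_tupleP (d : nat) (P : pred (seq T)) q :
  P q -> size q <= d -> [exists l : 'I_d.+1, exists p : l.-tuple T, P p].
Proof.
move=> Pq sq; apply/existsP; exists (Ordinal (sq : size q < d.+1)).
by apply/existsP; exists (in_tuple q).
Qed.

(** Shortcutting a walk to a path only drops vertices, so the remaining ones still lie weakly after
    z. *)
Lemma wreach_Q m z v : wreach m z v -> z != v -> z \in Q e s m v.
Proof.
move=> zv neq; have le := wreach_pos zv.
case: zv => p [pp lp sp /allP ap].
have [q jq [sq qp]] := walk_joins pp lp sp.
rewrite inE /weakly_accessible ltn_neqAle le andbT.
rewrite (contraNneq _ neq) => [/=|/pos_inj -> //].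
apply: (ex_tupleP (P := fun p => joins e z v p &&
  ((index z s <= index z s) && all (fun x => index z s <= index x s) p))) sq.
by rewrite jq leqnn /=; apply/allP => x /qp /ap.
Qed.

Lemma wreach_dist d z v : wreach d z v -> dist_le e d v z.
Proof.
case=> p [pp lp sp _].
have rp : path e v (rev (belast z p)).
  by rewrite -lp rev_path (eq_path (e' := e)) // => x y; rewrite /= esym.
have [|q jq [sq _]] := walk_joins (d := d) rp (erefl _).
  by rewrite size_rev size_belast.
apply: (ex_tupleP (P := fun q => joins e v z q)) sq.
suff -> : z = last v (rev (belast z p)) by [].
by case: p lp {pp sp rp jq} => [|x p] //= _; rewrite rev_cons last_rcons.
Qed.

(** The witness z is the vertex of the walk that comes first in the ordering, and the walk is split
    there. The last conjunct carries the induction: a new start before z becomes the witness, with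
    the whole walk on one side. *)
Lemma walk_min a p :
  path e a p ->
  exists z la lb, [/\ la + lb <= size p, wreach la z a, wreach lb z (last a p) &
                      all (fun x => pos z <= pos x) (a :: p)].
Proof.
elim: p a => [|x p IH] a /=.
  by move=> _; exists a, 0, 0; rewrite leqnn; split=> //; apply: wreach_refl.
case/andP=> eax pp; have [z [la [lb [hl ha hb hz]]]] := IH x pp.
case: (leqP (pos z) (pos a)) => [le|lt].
  exists z, la.+1, lb; rewrite le; split=> //.
  by apply: wreach_step ha _ le; rewrite esym.
have hall : all (fun y => pos a <= pos y) (x :: p).
  by apply: sub_all hz => y; apply: leq_trans; apply: ltnW.
exists a, 0, (size p).+1; rewrite leqnn; split=> //; first exact: wreach_refl.
exists (x :: p); split=> //=; by rewrite eax.
Qed.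
End Reach.

Lemma card_bigcup_leq (I J : finType) (A : {set I}) (G : I -> {set J}) c :
  (forall i, i \in A -> #|G i| <= c) -> #|\bigcup_(i in A) G i| <= c * #|A|.
Proof.
move=> hG; rewrite mulnC -sum_nat_const.
elim/big_rec2: _ => [|i b B iA IH]; first by rewrite cards0.
by apply: leq_trans (leq_add (hG _ iA) IH); rewrite cardsU leq_subr.
Qed.

(** * Extracting the two sets from an assignment *)

Section Extract.

Variables (T : finType) (e : rel T) (s : #|T|.-tuple T) (k m c : nat).
Hypotheses (esym : symmetric e) (us : uniq s) (m_le : m <= 2 * k + 1).
Hypothesis q_lt : forall v, q e s m v < c.

Definition reach_set v : {set T} := v |: Q e s m v.

Lemma reach_setP z v : wreach e s m z v -> z \in reach_set v.
Proof.
move=> zv; rewrite in_setU1; case: eqVneq => //= neq.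
exact: wreach_Q.
Qed.

Lemma card_reach_set v : #|reach_set v| <= c.
Proof.
apply: leq_trans (q_lt v).
by rewrite /q cardsU1; case: (_ \notin _) => //=; rewrite ltnW.
Qed.

(* [F z] is the centre responsible for putting z into the dominating set; the
   centres are the fixed points of [F]. *)
Variable F : T -> option T.
Hypotheses
  (F_centre : forall z a, F z = Some a -> F a = Some a /\ wreach e s m z a)
  (F_claimed : forall z a, F a = Some a -> wreach e s m z a ->
     exists2 x, F z = Some x & index x s <= index a s)
  (F_near : forall l z a, F a = Some a -> wreach e s l z a -> l <= k -> l <= m ->
     F z = Some a)
  (F_dom : forall v, F v = Some v \/ exists2 z, F z != None & wreach e s k z v).
(** The centres kept by the backward pass. [A_free] says that no kept centre was discarded by a
    later one, [A_cover] that every centre was kept (then b = z = a serves) or discarded. *)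
Variable A : {set T}.
Hypotheses
  (A_centre : forall b, b \in A -> F b = Some b)
  (A_free : forall a b z, a \in A -> b \in A -> index a s < index b s ->
     wreach e s m z b -> F z <> Some a)
  (A_cover : forall a, F a = Some a ->
     exists b z, [/\ b \in A, wreach e s m z b & F z = Some a]).

Let D := [set z | F z != None].

Lemma extract_dominating : dominating e k D.
Proof.
apply/forallP => v; apply/existsP; case: (F_dom v) => [Fv|[z Fz zv]].
  exists v; rewrite inE Fv /=; apply: (wreach_dist (s := s)) => //.
  exact: wreach_refl.
by exists z; rewrite inE Fz /=; apply: wreach_dist zv.
Qed.

Lemma extract_independent : independent e m A.
Proof.
apply/forall_inP => a aA; apply/forall_inP => b bA; apply/implyP => neq.
apply/negP => /existsP[l /existsP[p /and3P[pp _ /eqP lp]]].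
have [z [la [lb [hl za zb _]]]] := walk_min s esym pp.
rewrite {}lp in zb; rewrite size_tuple in hl.
have lm : l <= m by rewrite -ltnS.
(* Here x is the earlier centre. If ly <= k, then y owns z, although z has an owner no later than x.
   Otherwise lx <= k because m <= 2k + 1, so x owns z, against [A_free]. *)
have no x y lx ly : x \in A -> y \in A -> lx + ly <= m -> wreach e s lx z x ->
    wreach e s ly z y -> index x s < index y s -> False.
  move=> xA yA le zx zy lt.
  have [|w Fz wx] := F_claimed (A_centre xA) (z := z).
    by apply: wreachW zx; lia.
  have [le_ly|lt_ly] := leqP ly k.
    have Fy : F z = Some y by apply: F_near (A_centre yA) zy _ _; lia.
    by move: Fz wx; rewrite Fy => - [<-]; lia.
  have Fx : F z = Some x by apply: F_near (A_centre xA) zx _ _; lia.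
  by apply: (A_free xA yA lt _ Fx); apply: wreachW zy; lia.
case: (ltngtP (index a s) (index b s)) => [lt|lt|/(pos_inj us)].
- by apply: (no a b la lb) => //; lia.
- by apply: (no b a lb la) => //; lia.
by move/eqP; rewrite (negPf neq).
Qed.

(* Both factors of c come from the same bound on reachable sources: every centre
   claims at most c vertices, and every member of A discards at most c centres. *)
Lemma extract_card : #|D| <= c ^ 2 * #|A|.
Proof.
pose A' := [set a | F a == Some a].
have DA' : #|D| <= c * #|A'|.
  apply: leq_trans (_ : #|\bigcup_(a in A') reach_set a| <= _).
    apply: subset_leq_card; apply/subsetP => z; rewrite inE.
    case Fz: (F z) => [a|//] _; have [Fa za] := F_centre Fz.
    by apply/bigcupP; exists a; [rewrite inE Fa|exact: reach_setP].
  by apply: card_bigcup_leq => a _; apply: card_reach_set.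
have A'A : #|A'| <= c * #|A|.
  (* The owners of the vertices that reach b; the default for an unclaimed z can only enlarge this
     upper bound. *)
  pose G b := (fun z => odflt z (F z)) @: reach_set b.
  apply: leq_trans (_ : #|\bigcup_(b in A) G b| <= _).
    apply: subset_leq_card; apply/subsetP => a; rewrite inE => /eqP Fa.
    have [b [z [bA zb Fz]]] := A_cover Fa.
    apply/bigcupP; exists b => //; apply/imsetP; exists z; last by rewrite Fz.
    exact: reach_setP.
  apply: card_bigcup_leq => b _; apply: leq_trans (leq_imset_card _ _) _.
  exact: card_reach_set.
by apply: leq_trans DA' _; rewrite -mulnn -mulnA leq_mul2l A'A orbT.
Qed.

End Extract.

(** * Search records *)

Section Records.

Variables (T : finType) (e : rel T) (s : #|T|.-tuple T) (m c : nat).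
Hypotheses (esym : symmetric e) (irr : irreflexive e) (us : uniq s).
Hypothesis m_gt0 : 0 < m.
Hypothesis q_lt : forall v, q e s m v < c.

(* A record (z, v, r) witnesses a walk from z to v of length at most m + 1 - r
   that stays weakly after z in the ordering. *)
Implicit Types (recs : seq (T * T * nat)) (x : T * T * nat).

Definition sound_rec x : Prop :=
  0 < x.2 <= m.+1 /\ wreach e s (m.+1 - x.2) x.1.1 x.1.2.

Definition recs_at v recs := [seq x <- recs | x.1.2 == v].

(** The relaxation condition of shortest-path algorithms. A remainder of 1 means that the length m
    may be used up, and then nothing is required. *)
Definition closed_rec recs x : Prop :=
  forall w, e x.1.2 w -> index x.1.1 s <= index w s -> 1 < x.2 ->
  exists2 r, (x.1.1, w, r) \in recs & x.2.-1 <= r.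

Lemma sound_reach x : sound_rec x -> wreach e s m x.1.1 x.1.2.
Proof. by case=> /andP[x2 _]; apply: wreachW; rewrite leq_subLR -addn1 addnC leq_add2r. Qed.

(** A record at v is determined by its source, one of at most c vertices, and its remainder, one of
    m + 1 values. *)
Lemma size_recs_at v recs :
  uniq recs -> {in recs, forall x, sound_rec x} -> size (recs_at v recs) <= c * m.+1.
Proof.
move=> ur snd.
pose U := [seq ((z, v), r) | z <- enum (reach_set e s m v), r <- iota 1 m.+1].
apply: leq_trans (_ : size U <= _).
  apply: uniq_leq_size; first exact: filter_uniq.
  move=> [[z w] r]; rewrite mem_filter /= => /andP[/eqP -> xr].
  have /= [r_bnd _] := snd _ xr; have /= zv := sound_reach (snd _ xr).
  apply/allpairsP; exists (z, r); split=> //.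
    by rewrite mem_enum reach_setP.
  by rewrite mem_iota add1n.
by rewrite size_allpairs size_iota -cardE leq_mul2r card_reach_set.
Qed.

Lemma sum_recs_leq (f : T -> nat) recs :
  uniq recs -> {in recs, forall x, sound_rec x} ->
  \sum_(x <- recs) f x.1.2 <= c * m.+1 * \sum_v f v.
Proof.
move=> ur snd.
rewrite (partition_big (fun x => x.1.2) predT) //= big_distrr /=.
apply: leq_sum => v _.
rewrite (eq_bigr (fun=> f v)) => [|x /eqP -> //].
rewrite -big_filter big_const_seq count_predT iter_addn_0 mulnC leq_mul2r.
by rewrite size_recs_at ?orbT.
Qed.

(** Closure carries the starting record of z along the walk. The remainder drops by at most 1 per
    edge and exceeds 1 before each edge, since the walk has length at most m. *)
Lemma complete_recs recs z l v :
  {in recs, forall x, closed_rec recs x} -> (z, z, m.+1) \in recs ->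
  wreach e s l z v -> l <= m -> exists2 r, (z, v, r) \in recs & m < r + l.
Proof.
move=> clo zz [p [pp lp sp ap]] lm.
suff [r xr hr] : exists2 r, (z, v, r) \in recs & m < r + size p.
  by exists r => //; apply: leq_trans hr _; rewrite leq_add2l.
have {}sp : size p <= m by apply: leq_trans lm.
elim/last_ind: p v pp lp sp ap => [|p w IH] v /=.
  by move=> _ <- _ _; exists m.+1; rewrite ?addn0.
rewrite rcons_path last_rcons size_rcons all_rcons.
move=> /andP[pp ew] <- sp /andP[zw ap].
have [|r xr hr] := IH _ pp (erefl _) _ ap; first exact: ltnW.
have [|r' xr' hr'] := clo _ xr w ew zw; first by rewrite /=; lia.
by exists r' => //; move: hr' => /=; lia.
Qed.

(** The neighbours before v are weakly m-accessible from it, as m > 0, so there are fewer than c. By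
    double counting of edges, the later neighbours have the same total number as the earlier
    ones. *)
Lemma sum_deg_leq (adj : T -> seq T) :
  adjacency_lists e adj -> \sum_v (size (adj v)).+1 <= 2 * c * #|T|.
Proof.
move=> hadj.
have back v : #|[set w | e v w & index w s < index v s]| < c.
  apply: leq_ltn_trans (q_lt v); apply: subset_leq_card; apply/subsetP => w.
  rewrite inE => /andP[evw lt]; apply: wreach_Q => //.
    by exists [:: v]; split; rewrite //= ?andbT 1?esym // ltnW.
  by apply: contraTneq lt => ->; rewrite ltnn.
have deg v : size (adj v) = #|[set w | e v w & index w s < index v s]|
                          + #|[set w | e v w & index v s < index w s]|.
  have [uv hv] := hadj v; rewrite -(card_uniqP uv).
  rewrite -cardsUI [X in _ + #|pred_of_set X|](_ : _ = set0) ?cards0 ?addn0.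
    apply: eq_card => w; rewrite !inE hv -andb_orr -neq_ltn -[w \in e v]/(e v w).
    case evw: (e v w) => //=; symmetry; apply/negP => /eqP/(pos_inj us) wv.
    by rewrite wv irr in evw.
  by apply/setP => w; rewrite !inE; case: ltngtP; rewrite !andbF.
have -> : \sum_v (size (adj v)).+1 =
    \sum_v ((#|[set w | e v w & index w s < index v s]|.+1)
          + #|[set w | e v w & index w s < index v s]|).
  rewrite (eq_bigr (fun v => (#|[set w | e v w & index w s < index v s]|.+1)
          + #|[set w | e v w & index v s < index w s]|)); last first.
    by move=> v _; rewrite deg addSn.
  rewrite !big_split /=; congr (_ + _).
  under eq_bigr => v _ do rewrite -sum1dep_card big_mkcond.
  under [RHS]eq_bigr => v _ do rewrite -sum1dep_card big_mkcond.
  rewrite exchange_big; apply: eq_bigr => v _; apply: eq_bigr => w _.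
  by rewrite esym.
rewrite mulnC -sum_nat_const; apply: leq_sum => v _.
by have := back v; lia.
Qed.

End Records.

(** * Timed execution *)

(** A total-correctness judgement whose postcondition also sees the running time; nesting it for
    sequences turns proofs into forward symbolic execution. *)
Definition runs (c : cmd) (st : state) (P : state -> nat -> Prop) : Prop :=
  exists st' t, exec c st st' t /\ P st' t.

Lemma runs_conseq c st (P P' : state -> nat -> Prop) :
  runs c st P -> (forall st' t, P st' t -> P' st' t) -> runs c st P'.
Proof. by move=> [st' [t [ex h]]] hP; exists st', t; split=> //; apply: hP. Qed.

Lemma runs_skip st (P : state -> nat -> Prop) : P st 1 -> runs CSkip st P.
Proof. by exists st, 1; split=> //; apply: exec_skip. Qed.

Lemma runs_assign r a st (P : state -> nat -> Prop) :
  P (set_reg st r (eval st a)) (ecost a).+1 -> runs (CAssign r a) st P.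
Proof. by move=> h; eexists _, _; split; [apply: exec_assign|]. Qed.

Lemma runs_store b i a st (P : state -> nat -> Prop) :
  P (set_mem st b (eval st i) (eval st a)) (ecost i + ecost a).+1 ->
  runs (CStore b i a) st P.
Proof. by move=> h; eexists _, _; split; [apply: exec_store|]. Qed.

Lemma runs_seq c1 c2 st (P : state -> nat -> Prop) :
  runs c1 st (fun st1 t1 => runs c2 st1 (fun st2 t2 => P st2 (t1 + t2))) ->
  runs (CSeq c1 c2) st P.
Proof.
move=> [st1 [t1 [ex1 [st2 [t2 [ex2 h]]]]]].
by exists st2, (t1 + t2); split=> //; apply: exec_seq ex1 ex2.
Qed.

Lemma runs_if a c1 c2 st (P : state -> nat -> Prop) :
  (eval st a != 0 -> runs c1 st (fun st' t => P st' (ecost a + t).+1)) ->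
  (eval st a = 0 -> runs c2 st (fun st' t => P st' (ecost a + t).+1)) ->
  runs (CIf a c1 c2) st P.
Proof.
move=> h1 h2; case: (eqVneq (eval st a) 0) => [h0|h0].
  have [st' [t [ex h]]] := h2 h0.
  by eexists _, _; split; [apply: exec_if_false h0 ex|].
have [st' [t [ex h]]] := h1 h0.
by eexists _, _; split; [apply: exec_if_true h0 ex|].
Qed.

(* The ghost state g carries the invariant and a potential Phi, which pays for
   the iterations and also bounds their number. *)
Lemma runs_while (G : Type) (I : G -> state -> Prop) (Phi : G -> nat) a c :
  (forall g st, I g st -> eval st a != 0 ->
     runs c st (fun st' t => exists2 g', I g' st' &
                               t + (ecost a).+1 + Phi g' <= Phi g)) ->
  forall g st, I g st ->
  runs (CWhile a c) st (fun st' t => exists g', [/\ I g' st', eval st' a = 0 &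
                                       t + Phi g' <= Phi g + (ecost a).+1]).
Proof.
move=> body g; have [N le] := ubnP (Phi g); elim: N g le => // N IH g le st Ig.
case: (eqVneq (eval st a) 0) => [h0|h0].
  exists st, (ecost a).+1; split; first exact: exec_while_false.
  by exists g; split=> //; rewrite addnC.
have [st1 [t1 [ex1 [g1 Ig1 h1]]]] := body _ _ Ig h0.
have [|st2 [t2 [ex2 [g2 [Ig2 h2 ht]]]]] := IH g1 _ st1 Ig1.
  by apply: leq_trans (_ : Phi g <= _); lia.
eexists _, _; split; first exact: exec_while_true h0 ex1 ex2.
by exists g2; split=> //; lia.
Qed.

(** * The program *)

Section Program.

Let c_seq := foldr CSeq CSkip.

(* Banks 6, 7, 8 and 9 hold the records with their target, source, remainder and
   the previous record with the same target, and bank 5 the last record of each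
   target. Records are numbered from 1, so that 0 terminates the chains;
   register 7 is the first free number. *)
Definition push_cmd : cmd := c_seq
  [:: CStore 6 (EReg 7) (EReg 10);
      CStore 7 (EReg 7) (EReg 5);
      CStore 8 (EReg 7) (EReg 11);
      CStore 9 (EReg 7) (ELoad 5 (EReg 10));
      CStore 5 (EReg 10) (EReg 7);
      CAssign 7 (EAdd (EReg 7) (EConst 1))].

(* A vertex has a record exactly when it is not before the current source in the
   ordering, so the first test rejects the earlier vertices. *)
Definition relax_cmd : cmd := c_seq
  [:: CAssign 10 (ELoad 2 (EReg 9));
      CAssign 8 (ELoad 5 (EReg 10));
      CIf (EReg 8)
        (CIf (EAdd (EAdd (ESub (ELoad 7 (EReg 8)) (EReg 5))
                         (ESub (EReg 5) (ELoad 7 (EReg 8))))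
                   (ESub (EReg 11) (ELoad 8 (EReg 8))))
           push_cmd CSkip)
        CSkip;
      CAssign 9 (EAdd (EReg 9) (EConst 1))].

(** Register 6 is the number of the record to scan, 12 its target, 9 the position in bank 2, and 11
    the remainder of the records to be pushed. If the latter is 0, no edge may be appended. *)
Definition scan_cmd : cmd := c_seq
  [:: CAssign 5 (ELoad 7 (EReg 6));
      CAssign 12 (ELoad 6 (EReg 6));
      CAssign 11 (ESub (ELoad 8 (EReg 6)) (EConst 1));
      CAssign 9 (ELoad 1 (EReg 12));
      CIf (EReg 11)
        (CWhile (ESub (ELoad 1 (EAdd (EReg 12) (EConst 1))) (EReg 9)) relax_cmd)
        CSkip;
      CAssign 6 (EAdd (EReg 6) (EConst 1))].

Definition source_cmd : cmd := c_seq
  [:: CAssign 4 (ESub (EReg 4) (EConst 1));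
      CAssign 5 (ELoad 0 (EReg 4));
      CAssign 10 (EReg 5);
      CAssign 11 (EAdd (EReg 2) (EConst 1));
      push_cmd].

(** The list of records is itself the queue: those numbered from register 6 up to register 7 await
    scanning, and a new source starts only when none is left. A single loop for both actions lets
    one potential bound the whole search. *)
Definition search_cmd : cmd := c_seq
  [:: CAssign 4 (EReg 0);
      CAssign 6 (EConst 1);
      CAssign 7 (EConst 1);
      CWhile (EAdd (EReg 4) (ESub (EReg 7) (EReg 6)))
        (CIf (ESub (EReg 7) (EReg 6)) scan_cmd source_cmd)].

Definition each_rec_cmd (body : cmd) : cmd := c_seq
  [:: CAssign 8 (ELoad 5 (EReg 5));
      CWhile (EReg 8) (CSeq body (CAssign 8 (ELoad 9 (EReg 8))))].

(** Bank 3 holds the code of the owner plus 1, so that 0 means unclaimed. Register 9 drops to 0 when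
    a claimed source is within k steps; m + 1 - r <= k is tested as k + r - m being nonzero. *)
Definition claim_cmd : cmd := c_seq
  [:: CAssign 4 (EConst 0);
      CWhile (ESub (EReg 0) (EReg 4)) (c_seq
        [:: CAssign 5 (ELoad 0 (EReg 4));
            CAssign 9 (EConst 1);
            each_rec_cmd
              (CIf (ELoad 3 (ELoad 7 (EReg 8)))
                 (CIf (ESub (EAdd (EReg 1) (ELoad 8 (EReg 8))) (EReg 2))
                    (CAssign 9 (EConst 0)) CSkip)
                 CSkip);
            CIf (EReg 9)
              (each_rec_cmd
                 (CIf (ELoad 3 (ELoad 7 (EReg 8))) CSkip
                    (CStore 3 (ELoad 7 (EReg 8)) (EAdd (EReg 5) (EConst 1)))))
              CSkip;
            CAssign 4 (EAdd (EReg 4) (EConst 1))])].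

(** Register 4 still holds the number of vertices from the claiming loop. The two truncated
    differences add up to an absolute difference, which vanishes exactly for centres, the vertices
    owning themselves. Bank 10 marks discarded centres, addressed by code plus 1 as in bank 3. *)
Definition select_cmd : cmd :=
  CWhile (EReg 4) (c_seq
    [:: CAssign 4 (ESub (EReg 4) (EConst 1));
        CAssign 5 (ELoad 0 (EReg 4));
        CIf (EAdd (EAdd (ESub (ELoad 3 (EReg 5)) (EAdd (EReg 5) (EConst 1)))
                        (ESub (EAdd (EReg 5) (EConst 1)) (ELoad 3 (EReg 5))))
                  (ELoad 10 (EAdd (EReg 5) (EConst 1))))
          CSkip
          (CSeq (CStore 4 (EReg 5) (EConst 1))
             (each_rec_cmd (CStore 10 (ELoad 3 (ELoad 7 (EReg 8))) (EConst 1))))]).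

Definition main_cmd : cmd := CSeq search_cmd (CSeq claim_cmd select_cmd).

End Program.

(** * Data representation *)

Lemma nth_flatten_sumn (U : Type) (x0 : U) (ss : seq (seq U)) r i :
  i < size (nth [::] ss r) ->
  nth x0 (flatten ss) (sumn (take r (shape ss)) + i) = nth x0 (nth [::] ss r) i.
Proof.
elim: ss r => [|t ss IH] [|r] //= lt_i; first by rewrite nth_cat lt_i.
by rewrite nth_cat -addnA ltnNge leq_addr addKn /= IH.
Qed.

Ltac run := first [ apply: runs_seq | apply: runs_assign | apply: runs_store
                  | apply: runs_skip ]; rewrite /=.

Section Representation.

Variables (T : finType) (adj : T -> seq T) (s : #|T|.-tuple T) (k m : nat).

Implicit Types (recs : seq (T * T * nat)) (x : T * T * nat) (v w : T).

Definition code v : nat := enum_rank v.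

Lemma code_inj : injective code.
Proof. by move=> v w /val_inj/enum_rank_inj. Qed.

Lemma eq_code v w : (code v == code w) = (v == w).
Proof. exact: inj_eq code_inj v w. Qed.

(** Record numbers start from 1. If no record has target v, [find] returns the full size and the
    value is 0, the end of a chain. *)
Definition last_at recs v : nat :=
  size recs - find (fun x => x.1.2 == v) (rev recs).

Lemma last_at_rcons recs x v :
  last_at (rcons recs x) v = if x.1.2 == v then (size recs).+1 else last_at recs v.
Proof.
rewrite /last_at size_rcons rev_rcons /=.
by case: ifP => _; rewrite ?subn0 ?subSS.
Qed.

Lemma last_atP recs v :
  (last_at recs v = 0 /\ recs_at v recs = [::]) \/
  (exists rs x rs', [/\ recs = rs ++ x :: rs', x.1.2 = v, recs_at v rs' = [::] &
                        last_at recs v = (size rs).+1]).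
Proof.
elim/last_ind: recs => [|recs y IH]; first by left.
rewrite last_at_rcons; case: eqVneq => [yv|yv].
  by right; exists recs, y, [::]; rewrite cats1.
case: IH => [[-> h]|[rs [x [rs' [-> xv h ->]]]]].
  by left; rewrite /recs_at filter_rcons (negPf yv).
right; exists rs, x, (rcons rs' y).
by rewrite rcons_cat /recs_at filter_rcons (negPf yv).
Qed.

Definition env st : Prop :=
  [/\ reg st 0 = #|T|, reg st 1 = k, reg st 2 = m,
      (forall v, cell st 0 (index v s) = code v) &
      (forall v, cell st 1 (code v).+1 = cell st 1 (code v) + size (adj v) /\
         forall a w b, adj v = a ++ w :: b ->
           cell st 2 (cell st 1 (code v) + size a) = code w)].

Definition log recs st : Prop :=
  [/\ reg st 7 = (size recs).+1,
      (forall v, cell st 5 (code v) = last_at recs v) &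
      (forall rs x rs', recs = rs ++ x :: rs' ->
         [/\ cell st 6 (size rs).+1 = code x.1.2, cell st 7 (size rs).+1 = code x.1.1,
             cell st 8 (size rs).+1 = x.2 &
             cell st 9 (size rs).+1 = last_at rs x.1.2])].

Definition rep recs st : Prop := env st /\ log recs st.

Lemma env_set_reg st r y : r \notin [:: 0; 1; 2] -> env st -> env (set_reg st r y).
Proof.
rewrite !inE !negb_or => /and3P[r0 r1 r2] [h0 h1 h2 h3 h4].
by split; rewrite //= eq_sym ?(negPf r0) ?(negPf r1) ?(negPf r2).
Qed.

Lemma rep_set_reg recs st r y :
  r \notin [:: 0; 1; 2; 7] -> rep recs st -> rep recs (set_reg st r y).
Proof.
move=> hr [he [h5 h6 h7]]; split.
  by apply: env_set_reg he; move: hr; rewrite !inE !negb_or => /and4P[-> -> ->].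
split=> //=; move: hr; rewrite !inE !negb_or => /and4P[_ _ _ r7].
by rewrite eq_sym (negPf r7).
Qed.

Lemma rep_set_mem recs st b i y :
  b \in [:: 3; 4; 10] -> rep recs st -> rep recs (set_mem st b i y).
Proof.
move=> hb [[h0 h1 h2 h3 h4] [h5 h6 h7]].
by move: hb; rewrite !inE => /or3P[] /eqP ->.
Qed.

Lemma env_input c : uniq s -> env (input adj s k m c).
Proof.
move=> us; split=> //= [v|v].
  rewrite (nth_map v) ?nth_index ?ordering_mem //.
  by rewrite index_mem ordering_mem.
set lists := [seq _ | v <- enum T].
have sz : size lists = #|T| by rewrite size_map cardE.
have nl : nth [::] lists (code v) = [seq code w | w <- adj v].
  rewrite (nth_map v) -?cardE; last exact: ltn_ord.
  by rewrite nth_enum_rank.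
have off i : i <= #|T| ->
    nth 0 [seq sumn (take i (shape lists)) | i <- 0 :: iota 1 #|T|] i =
    sumn (take i (shape lists)).
  move=> le; rewrite -[0 :: _]/(iota 0 #|T|.+1) (nth_map 0) ?size_iota //.
  by rewrite nth_iota.
have lt_v : code v < #|T| by apply: ltn_ord.
have off0 := off _ (ltnW lt_v); have off1 := off _ lt_v.
rewrite /= in off0 off1; rewrite {}off0 {}off1; split.
  rewrite (take_nth 0); last by rewrite size_map sz.
  by rewrite sumn_rcons (nth_map [::]) ?sz // nl size_map.
move=> a w b av; rewrite nth_flatten_sumn nl av.
  by rewrite map_cat nth_cat size_map ltnn subnn.
by rewrite size_map size_cat /= addnS ltnS leq_addr.
Qed.

Lemma log_nil st : reg st 7 = 1 -> (forall i, cell st 5 i = 0) -> log [::] st.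
Proof. by split=> // [[|? ?]]. Qed.

Lemma runs_push recs z w r st :
  rep recs st -> reg st 5 = code z -> reg st 10 = code w -> reg st 11 = r ->
  runs push_cmd st (fun st' t =>
    [/\ rep (rcons recs (z, w, r)) st', forall i, i != 7 -> reg st' i = reg st i,
        forall b i, b \in [:: 1; 3; 4; 10] -> cell st' b i = cell st b i & t <= 30]).
Proof.
move=> [[h0 h1 h2 h3 h4] [h5 h6 h7]] hz hw hr.
do 13 run; split=> //; first last.
- by move=> b i; rewrite !inE => /or4P[] /eqP ->.
- by move=> i /negPf ->.
split; split=> //=.
- by rewrite h5 size_rcons addn1.
- by move=> v; rewrite hw h5 eq_code last_at_rcons /= eq_sym h6.
move=> rs x rs'; case/lastP: rs' => [|rs' y].
  rewrite cats1 => /rcons_inj[<- <-]; rewrite h5 !eqxx /= hz hw hr.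
  by split.
rewrite -rcons_cons -rcons_cat => /rcons_inj[hrecs _].
have [h71 h72 h73 h74] := h7 _ _ _ hrecs.
have lt : (size rs).+1 == reg st 7 = false.
  by rewrite h5 hrecs size_cat /= addnS; apply/eqP; lia.
by rewrite lt /=.
Qed.

Lemma runs_each_rec recs v body (I : seq (T * T * nat) -> state -> Prop) K st :
  (forall dn st i, I dn st -> I dn (set_reg st 8 i)) ->
  (forall dn x st, x \in recs -> x.1.2 = v -> rep recs st -> reg st 5 = code v ->
     I dn st -> cell st 7 (reg st 8) = code x.1.1 -> cell st 8 (reg st 8) = x.2 ->
     runs body st (fun st' t => [/\ rep recs st', reg st' 5 = code v,
                     reg st' 8 = reg st 8, I (x :: dn) st' & t <= K])) ->
  rep recs st -> reg st 5 = code v -> I [::] st ->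
  runs (each_rec_cmd body) st (fun st' t =>
    [/\ rep recs st', reg st' 5 = code v, I (recs_at v recs) st' &
        t <= 8 + (K + 6) * size (recs_at v recs)]).
Proof.
move=> I8 hbody hrep h5 hI; run; run.
pose J (g : seq (T * T * nat) * seq (T * T * nat)) st :=
  [/\ rep recs st, reg st 5 = code v, recs = g.1 ++ g.2,
      reg st 8 = last_at g.1 v & I (recs_at v g.2) st].
pose Phi (g : seq (T * T * nat) * seq (T * T * nat)) :=
  (K + 6) * size (recs_at v g.1).
run; apply: (runs_conseq (runs_while (I := J) (Phi := Phi) _ (g := (recs, [::])) _)).
- move=> [rs rs'] st1 [/= hrep1 h51 hrecs h81 I1] nz.
  case: (last_atP rs v) => [[h _]|[rs1 [x [rs2 [hrs xv h2 hl]]]]].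
    by rewrite h81 h in nz.
  have hrecs' : recs = rs1 ++ x :: (rs2 ++ rs') by rewrite hrecs hrs -catA.
  have [_ [_ _ h7]] := hrep1; have [_ c7 c8 _] := h7 _ _ _ hrecs'.
  have xr : x \in recs by rewrite hrecs' mem_cat inE eqxx orbT.
  rewrite -hl -h81 in c7 c8.
  run; have [st2 [t2 [ex [hrep2 h52 h82 I2 ht]]]] :=
    hbody _ x _ xr xv hrep1 h51 I1 c7 c8.
  exists st2, t2; split=> //; run.
  exists (rs1, x :: rs2 ++ rs').
    split=> //=.
      have [_ [_ _ h7']] := hrep2; have [_ _ _] := h7' _ _ _ hrecs'.
      by rewrite h82 h81 hl xv.
    apply: I8; rewrite xv eqxx /recs_at filter_cat -/(recs_at v rs2) h2.
    exact: I2.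
  rewrite /Phi hrs /= /recs_at filter_cat /= xv eqxx -!/(recs_at v _) h2.
  by rewrite size_cat /=; lia.
- split=> //=; rewrite ?cats0 //.
    by have [_ [_ h6 _]] := hrep; rewrite h5 h6.
  exact: I8.
move=> st1 t1 /= [[rs rs'] [[/= hrep1 h51 hrecs h81 I1] e0 ht]].
run; split=> //; last by move: ht; rewrite /Phi /=; lia.
case: (last_atP rs v) => [[_ h]|[rs1 [x [rs2 [_ _ _ hl]]]]].
  by rewrite hrecs /recs_at filter_cat -/(recs_at v rs) h.
by rewrite h81 hl in e0.
Qed.

End Representation.

(** * The search phase *)

Section Search.

Variables (T : finType) (e : rel T) (adj : T -> seq T) (s : #|T|.-tuple T).
Variables (k m c : nat).
Hypotheses (esym : symmetric e) (irr : irreflexive e) (us : uniq s).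
Hypotheses (m_gt0 : 0 < m) (hadj : adjacency_lists e adj).
Hypothesis q_lt : forall v, q e s m v < c.

Implicit Types (recs : seq (T * T * nat)) (x : T * T * nat) (v w z : T).

Let pos v := index v s.

(* For the current source, the last record of a target has the largest remainder;
   comparing with it alone therefore keeps the records distinct. *)
Definition last_best i recs : Prop :=
  forall rs y rs', recs = rs ++ y :: rs' -> recs_at y.1.2 rs' = [::] ->
  forall x, x \in recs -> index x.1.1 s = i -> x.1.2 = y.1.2 ->
  y.1.1 = x.1.1 /\ x.2 <= y.2.

(** Here h counts the records already scanned and i is the position of the current source. *)
Definition search_inv i h recs : Prop :=
  [/\ uniq recs,
      {in recs, forall x, sound_rec e s m x /\ i <= index x.1.1 s},
      {in take h recs, forall x, closed_rec e s recs x},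
      {in drop h recs, forall x, index x.1.1 s = i} &
      last_best i recs].

Definition started i recs : Prop :=
  forall z, i <= index z s -> (z, z, m.+1) \in recs.

Lemma closed_rec_rcons recs y x :
  closed_rec e s recs x -> closed_rec e s (rcons recs y) x.
Proof.
move=> clo w ew le lt; have [r xr hr] := clo w ew le lt.
by exists r => //; rewrite mem_rcons inE xr orbT.
Qed.

Lemma started_rcons i recs y : started i recs -> started i (rcons recs y).
Proof. by move=> h z /h zr; rewrite mem_rcons inE zr orbT. Qed.

(** A strict improvement on all records of the same pair yields distinctness, and also [last_best],
    as the new record becomes the last one of its target. *)
Lemma search_inv_rcons i h recs z w r :
  search_inv i h recs -> h <= size recs -> index z s = i ->
  sound_rec e s m (z, w, r) -> (forall r', (z, w, r') \in recs -> r' < r) ->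
  search_inv i h (rcons recs (z, w, r)).
Proof.
move=> [ur snd clo cur best] hle zi snd_x nodom; split.
- rewrite rcons_uniq ur andbT; apply/negP => /nodom; by rewrite ltnn.
- move=> x; rewrite mem_rcons inE => /predU1P[->|/snd//].
  by rewrite zi.
- rewrite -cats1 takel_cat // cats1 => x /clo.
  exact: closed_rec_rcons.
- rewrite -cats1 drop_cat; case: ltnP => [_|ge] x.
    by rewrite mem_cat inE => /orP[/cur//|/eqP ->].
  have -> : h = size recs by apply/eqP; rewrite eqn_leq hle.
  by rewrite subnn /= inE => /eqP ->.
move=> rs y rs'; case/lastP: rs' => [|rs' y'].
  rewrite cats1 => /rcons_inj[_ <-] _ x; rewrite mem_rcons inE.
  case/predU1P=> [-> //|xr] xi /= xw.
  have xz : x.1.1 = z by apply: (pos_inj us); rewrite xi zi.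
  split=> //; apply/ltnW/nodom.
  by case: x xr xz xw {xi} => [[? ?] ?] /= xr <- <-.
rewrite -rcons_cons -rcons_cat => /rcons_inj[hrecs <-].
rewrite /recs_at filter_rcons /=; case: eqVneq => [|neq].
  by move=> _ /(congr1 size); rewrite size_rcons.
move=> hy x; rewrite mem_rcons inE => /predU1P[-> _ /eqP|].
  by rewrite /= (negPf neq).
exact: (best _ _ _ hrecs hy).
Qed.

Let quiet st := forall b j, b \in [:: 3; 4; 10] -> cell st b j = 0.

Let represents := rep adj s k m.

Lemma runs_relax i h recs z v w r st :
  search_inv i h recs -> started i recs -> h <= size recs -> index z s = i ->
  (z, v, r.+1) \in recs -> 0 < r -> e v w -> represents recs st ->
  reg st 5 = code z -> reg st 11 = r -> cell st 2 (reg st 9) = code w ->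
  runs relax_cmd st (fun st' t => exists recs',
    [/\ represents recs' st', search_inv i h recs', started i recs',
        exists rs, recs' = recs ++ rs &
        (pos z <= pos w -> exists2 r', (z, w, r') \in recs' & r <= r')] /\
    [/\ reg st' 9 = (reg st 9).+1,
        forall b, b \notin [:: 7; 8; 9; 10] -> reg st' b = reg st b,
        forall b j, b \in [:: 1; 3; 4; 10] -> cell st' b j = cell st b j & t <= 63]).
Proof.
move=> inv stt hle zi xr r_gt0 evw hrep h5 h11 h9.
have [ur snd clo cur best] := inv.
have [_ [_ hlast hrec]] := hrep.
do 4 run; rewrite h9 hlast; run.
pose st1 := set_reg (set_reg st 10 (code w)) 8 (last_at recs w).
rewrite -/st1.
have rep1 : represents recs st1 by do 2 apply: rep_set_reg => //.
(* Both branches that push nothing leave the log unchanged; only the record for w remains to be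
   exhibited. *)
have skip : (pos z <= pos w -> exists2 r', (z, w, r') \in recs & r <= r') ->
    exists recs',
    [/\ represents recs' (set_reg st1 9 (reg st 9 + 1)), search_inv i h recs',
        started i recs', exists rs, recs' = recs ++ rs &
        (pos z <= pos w -> exists2 r', (z, w, r') \in recs' & r <= r')].
  move=> H; exists recs; split=> //.
  by exists [::]; rewrite cats0.
have frame : forall b, b \notin [:: 7; 8; 9; 10] ->
    reg (set_reg st1 9 (reg st 9 + 1)) b = reg st b.
  move=> b; rewrite !inE !negb_or => /and4P[_ b8 b9 b10] /=.
  by rewrite (negPf b9) (negPf b8) (negPf b10).
apply: runs_if => /=.
  case: (last_atP recs w) => [[-> //]|[rs [y [rs' [hrecs yw hrs' hl]]]]] _.
  have [_ c7 c8 _] := hrec _ _ _ hrecs.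
  have yr : y \in recs by rewrite hrecs mem_cat inE eqxx orbT.
  apply: runs_if => /=; rewrite hl c7 c8 h5 h11 => test.
    have [[r_bnd /= zv] _] := snd _ xr.
    (* The existence of any record at w suffices: its source is not before z and reaches w. *)
    have zw : pos z <= pos w.
      have [[_ /wreach_pos yy] iy] := snd _ yr.
      by rewrite /pos zi -yw; apply: leq_trans yy.
    have snd_w : sound_rec e s m (z, w, r).
      split=> /=; first by move: r_bnd => /=; lia.
      rewrite subSn; last by move: r_bnd => /=; lia.
      by rewrite subSS in zv; apply: wreach_step zv evw zw.
    (* If z has a record at w, then by [last_best] the last record y at w has source z and the
       largest remainder, and the test says that this is below r. *)
    have nodom r' : (z, w, r') \in recs -> r' < r.
      rewrite -yw in hrs' => zwr.
      have /= [||yz le] := best _ _ _ hrecs hrs' _ zwr => //.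
      by move: test; rewrite yz; lia.
    have [] := runs_push (z := z) (w := w) (r := r) rep1 => //.
    move=> st2 [t2 [ex [rep2 frame2 mem2 ht2]]].
    exists st2, t2; split=> //.
    do 3 run; exists (rcons recs (z, w, r)); split; split.
    - exact: rep_set_reg.
    - exact: search_inv_rcons.
    - exact: started_rcons.
    - by exists [:: (z, w, r)]; rewrite cats1.
    - by move=> _; exists r => //; rewrite mem_rcons mem_head.
    - by rewrite frame2 //= addn1.
    - move=> b hb; rewrite -frame //=.
      move: hb; rewrite !inE !negb_or => /and4P[b7 b8 b9 b10].
      by rewrite (negPf b9) frame2 //= (negPf b8).
    - by move=> b j hb /=; rewrite mem2.
    by lia.
  do 4 run.
  have [|recs' h'] := skip; last first.
    by exists recs'; split=> //; split=> //=; rewrite ?addn1 //; lia.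
  move=> _; exists y.2; last by move: test; lia.
  suff <- : y = (z, w, y.2) by [].
  have /code_inj yz : code y.1.1 = code z by lia.
  by case: y yw yz {c7 c8 hrs' hrecs yr test} => [[? ?] ?] /= -> ->.
move=> l0; do 4 run.
have [|recs' h'] := skip; last first.
  by exists recs'; split=> //; split=> //=; rewrite ?addn1 //; lia.
(* The case is contradictory: a vertex w not before z has its own starting record, so its chain
   cannot be empty. The witness is a placeholder. *)
move=> le; exists m.+1; last by have [[/= ? _] _] := snd _ xr; lia.
case: (last_atP recs w) => [[_ h0]|[rs [y [rs' [_ _ _ hl]]]]].
  have : (w, w, m.+1) \in recs_at w recs.
    by rewrite mem_filter eqxx stt //= -zi.
  by rewrite h0.
by rewrite hl in l0.
Qed.

Lemma runs_scan i rs x rs' st :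
  let recs := rs ++ x :: rs' in let h := size rs in
  search_inv i h recs -> started i recs ->
  represents recs st -> reg st 6 = h.+1 -> reg st 4 = i -> quiet st ->
  runs scan_cmd st (fun st' t => exists recs',
    [/\ represents recs' st', search_inv i h.+1 recs', started i recs',
        h < size recs' & take h.+1 recs' = take h.+1 recs] /\
    [/\ reg st' 6 = h.+2, reg st' 4 = i, quiet st' &
        t <= 50 + 70 * size (adj x.1.2)]).
Proof.
move=> recs h inv stt hrep h6 h4 hq.
have [_ [_ _ /(_ _ _ _ erefl)]] := hrep; rewrite -/h => -[c6 c7 c8 _].
have [ur snd clo cur best] := inv.
have xr : x \in recs by rewrite mem_cat inE eqxx orbT.
have zi : pos x.1.1 = i.
  by apply: cur; rewrite drop_size_cat // mem_head.
have [[x2 _] _] := snd _ xr.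
do 9 run; rewrite h6 c6 c7 c8.
set st1 := set_reg _ _ _.
have rep1 : represents recs st1 by do 4 apply: rep_set_reg => //.
have hw w : (w \in adj x.1.2) = e x.1.2 w by case: (hadj x.1.2) => _ ->.
have tk ts : take h.+1 (recs ++ ts) = rcons rs x.
  by rewrite /recs -catA cat_cons -cat_rcons take_size_cat ?size_rcons.
(* Pushing only appends, so the scanned prefix grows by exactly x, whose closure is the only new
   obligation. *)
have close recs' ts : recs' = recs ++ ts -> search_inv i h recs' ->
    closed_rec e s recs' x -> search_inv i h.+1 recs'.
  move=> hrecs' [ur' snd' clo' cur' best'] clo_x; split=> //.
    move=> y; rewrite hrecs' tk mem_rcons inE => /predU1P[->|yr].
      by rewrite -hrecs'.
    rewrite -hrecs'; apply: clo'.
    by rewrite hrecs' /recs -catA take_size_cat.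
  move=> y yr; apply: cur'; move: yr.
  by rewrite -addn1 addnC -drop_drop => /mem_drop.
apply: runs_if => /= nz.
  pose J (g : seq (T * T * nat) * seq T * seq T) st :=
    let: (recs', dn, rest) := g in
    [/\ represents recs' st, search_inv i h recs', started i recs',
        exists ts, recs' = recs ++ ts & adj x.1.2 = dn ++ rest] /\
    [/\ {in dn, forall w, pos x.1.1 <= pos w ->
           exists2 r, (x.1.1, w, r) \in recs' & x.2.-1 <= r},
        reg st 9 = cell st 1 (code x.1.2) + size dn,
        forall b, b \in [:: 4; 5; 6; 11; 12] -> reg st b = reg st1 b &
        quiet st].
  pose Phi (g : seq (T * T * nat) * seq T * seq T) := 70 * size g.2.
  apply: (runs_conseq (runs_while (I := J) (Phi := Phi) _
                         (g := (recs, [::], adj x.1.2)) _)).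
  - move=> [[recs' dn] rest] st2 [[rep2 inv2 stt2 [ts hts] hdn] [clo2 h92 fr2 q2]].
    have [[_ _ _ _ /(_ x.1.2) [hend hcell]] _] := rep2.
    rewrite /= addn1 fr2 //= hend h92 hdn size_cat => nz2.
    case: rest hdn nz2 => [|w rest] hdn /= nz2; first by lia.
    apply: (runs_conseq (@runs_relax i h recs' x.1.1 x.1.2 w x.2.-1 st2 _ _ _ _ _ _ _ _ _ _ _)) => //.
    - by rewrite hts /recs -catA size_cat leq_addr.
    - rewrite prednK; last by lia.
      by rewrite hts mem_cat; case: (x) xr => [[? ?] ?] /= ->.
    - by lia.
    - by rewrite -hw hdn mem_cat mem_head orbT.
    - by rewrite fr2.
    - by rewrite fr2 //= subn1.
    - by rewrite h92; apply: hcell hdn.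
    move=> st3 t3 [recs3 [[rep3 inv3 stt3 [ts3 hts3] clo3] [h93 fr3 mem3 ht3]]].
    exists (recs3, rcons dn w, rest); last by rewrite /Phi /=; lia.
    split; split=> //.
    - by exists (ts ++ ts3); rewrite hts3 hts catA.
    - by rewrite cat_rcons.
    - move=> u; rewrite mem_rcons inE => /predU1P[-> //|udn] le.
      have [r ur3 hr] := clo2 _ udn le; exists r => //.
      by rewrite hts3 mem_cat ur3.
    - rewrite h93 h92 size_rcons addnS; congr (_ + _).+1.
      by rewrite mem3.
    - move=> b hb; rewrite fr3 ?fr2 //.
      by move: hb; rewrite !inE => /or4P[|||/orP[]] /eqP ->.
    - by move=> b j hb; rewrite mem3 ?q2 // inE hb orbT.
  - split; split=> //; first by exists [::]; rewrite cats0.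
    by rewrite /= addn0.
  move=> st2 t2 [[[recs' dn] rest] [[[rep2 inv2 stt2 [ts hts] hdn] [clo2 h92 fr2 q2]] /= e0 ht]].
  have [[_ _ _ _ /(_ x.1.2) [hend _]] _] := rep2.
  have rest0 : rest = [::].
    by apply/nilP; move: e0; rewrite addn1 fr2 //= hend h92 hdn size_cat /nilp; lia.
  do 3 run; exists recs'; split; split=> //.
  - apply: (close _ ts) => // w ew le lt; apply: clo2 => //.
    by move: ew; rewrite -hw hdn rest0 cats0.
  - by rewrite hts /recs !size_cat /=; rewrite /h; lia.
  - by rewrite hts tk -[recs]cats0 tk.
  - by rewrite /= fr2 //= h6 addn1.
  - by rewrite /= fr2.
  - by move: ht; rewrite /Phi /=; lia.
(* The remainder of x is 1 here, so its closure holds vacuously. *)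
do 4 run; exists recs; split; split=> //.
- by apply: (close _ [::]); rewrite ?cats0 // => w ew le lt; lia.
- by rewrite /recs size_cat /= addnS ltnS leq_addr.
by rewrite /= h6 addn1.
Qed.

Lemma runs_source i recs st :
  search_inv i.+1 (size recs) recs -> started i.+1 recs -> i < #|T| ->
  represents recs st -> reg st 4 = i.+1 -> quiet st ->
  runs source_cmd st (fun st' t => exists z, let recs' := rcons recs (z, z, m.+1) in
    [/\ represents recs' st', search_inv i (size recs) recs' & started i recs'] /\
    [/\ reg st' 4 = i, reg st' 6 = reg st 6, quiet st' & t <= 46]).
Proof.
move=> [ur snd clo cur best] stt lt_i hrep h4 hq.
have [z zi] := pos_surj us lt_i; move: (zi); rewrite /= => {}zi.
have [[_ _ h2 h0 _] _] := hrep.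
do 9 run; rewrite h4 subn1 /= -zi h0 h2 addn1.
set st1 := set_reg _ _ _.
have rep1 : represents recs st1 by do 4 apply: rep_set_reg => //.
have [] := runs_push (z := z) (w := z) (r := m.+1) rep1 => //.
move=> st2 [t2 [ex [rep2 frame2 mem2 ht2]]].
exists st2, t2; split=> //; run; exists z; split; split=> //.
(* All older records have sources after position i, so the conditions on records of the current
   source hold vacuously before the push. *)
- apply: search_inv_rcons => //.
  + split=> //.
    * by move=> x xr; have [? /ltnW] := snd _ xr; rewrite zi.
    * by move=> x; rewrite drop_size.
    * by move=> rs y rs' _ _ x xr xz; have [_] := snd _ xr; rewrite xz; lia.
  + by split=> /=; [rewrite leqnn | apply: wreach_refl].
  + move=> r zr; have [_ /=] := snd _ zr; rewrite zi; lia.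
- move=> w; rewrite leq_eqVlt mem_rcons inE => /predU1P[/(pos_inj us) ->|].
    by rewrite eqxx.
  by rewrite zi => /stt ->; rewrite orbT.
- by rewrite frame2 //= zi.
- by rewrite frame2.
- by move=> b j hb; rewrite mem2; [exact: hq | rewrite inE hb orbT].
by lia.
Qed.

Lemma runs_search :
  runs search_cmd (input adj s k m c) (fun st t => exists recs,
    [/\ represents recs st, quiet st, uniq recs &
        {in recs, forall x, sound_rec e s m x}] /\
    [/\ forall z v l, wreach e s l z v -> l <= m ->
          exists2 r, (z, v, r) \in recs & m < r + l &
        t <= 60 * #|T| + 100 * (c * m.+1 * (2 * c * #|T|)) + 20]).
Proof.
do 7 run; set st1 := set_reg _ _ _.
have rep1 : represents [::] st1.
  split; first by do 3 apply: env_set_reg => //; apply: env_input.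
  by apply: log_nil => // i; rewrite /= nth_nil.
pose wt recs := \sum_(x <- recs) (size (adj x.1.2)).+1.
pose W := c * m.+1 * (2 * c * #|T|).
have wtW recs : uniq recs -> {in recs, forall x, sound_rec e s m x} -> wt recs <= W.
  move=> ur snd; 
  apply: leq_trans (sum_recs_leq us q_lt (fun v => (size (adj v)).+1) ur snd) _.
  by rewrite leq_mul2l (sum_deg_leq esym irr us m_gt0 q_lt hadj) orbT.
pose J (g : nat * nat * seq (T * T * nat)) st := let: (i, h, recs) := g in
  [/\ represents recs st, quiet st, reg st 4 = i & reg st 6 = h.+1] /\
  [/\ i <= #|T|, h <= size recs, search_inv i h recs & started i recs].
(* Each source still to come is paid by 60. A scan is paid by the weight of its record, and the
   distinct, sound records weigh at most [W] in total. *)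
pose Phi (g : nat * nat * seq (T * T * nat)) :=
  60 * g.1.1 + 100 * (W - wt (take g.1.2 g.2)).
apply: (runs_conseq (runs_while (I := J) (Phi := Phi) _
                            (g := (#|T|, 0, [::])) _)).
- move=> [[i h] recs] st2 [[rep2 q2 h4 h6] [ile hle inv stt]] /=.
  have [_ [h7 _ _]] := rep2.
  rewrite h4 h6 h7 => nz; apply: runs_if => /=; rewrite h6 h7 => test.
    have lt : h < size recs by lia.
    case: recs => [|x0 recs0] in rep2 hle inv stt h7 nz test lt *; first by [].
    set recs := x0 :: recs0 in rep2 hle inv stt h7 nz test lt *.
    have hrecs : recs = take h recs ++ nth x0 recs h :: drop h.+1 recs.
      by rewrite -drop_nth ?cat_take_drop.
    have sz : size (take h recs) = h by rewrite size_take lt.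
    have := @runs_scan i (take h recs) (nth x0 recs h) (drop h.+1 recs) st2.
    rewrite /= -hrecs sz => /(_ inv stt rep2 h6 h4 q2) hrun.
    apply: (runs_conseq hrun) => st3 t3.
    move=> [recs3 [[rep3 inv3 stt3 lt3 tk3] [h63 h43 q3 ht3]]].
    exists (i, h.+1, recs3) => //; rewrite /Phi /= tk3.
    have : wt (take h.+1 recs) <= W.
      have [ur snd _ _ _] := inv; apply: wtW; first exact: take_uniq.
      by move=> x /mem_take /snd[].
    rewrite (take_nth x0) // /wt -cats1 big_cat big_seq1 /=; lia.
  have hs : h = size recs by lia.
  case: i => [|i] in h4 ile inv stt nz *; first by lia.
  rewrite hs in inv.
  apply: (runs_conseq (runs_source inv stt ile rep2 h4 q2)) => st3 t3.
  move=> [z [[rep3 inv3 stt3] [h43 h63 q3 ht3]]].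
  exists (i, h, rcons recs (z, z, m.+1)); last first.
    by rewrite /Phi /= hs -cats1 takel_cat // mulnS; lia.
  split; split=> //; rewrite ?h63 ?hs ?size_rcons // -?hs // ltnW //.
- split; split=> //.
    by move=> b j; rewrite !inE => /or3P[] /eqP ->; rewrite /= nth_nil.
  by move=> z; rewrite leqNgt pos_lt.
move=> st2 t2 [[[i h] recs] [[[rep2 q2 h4 h6] [ile hle inv stt]] /= e0 ht]].
have [_ [h7 _ _]] := rep2; rewrite h4 h6 h7 in e0.
have hs : h = size recs by lia.
have i0 : i = 0 by lia.
have [ur snd clo _ _] := inv; rewrite hs take_size in clo.
run; exists recs; split; split=> //.
- by move=> x /snd[].
- by move=> z v l; apply: complete_recs => //; apply: stt; rewrite i0.
by move: ht; rewrite /Phi /= /wt big_nil -/W subn0; lia.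
Qed.

End Search.

(** * The claiming and selection phases *)

Section Claim.

Variables (T : finType) (e : rel T) (adj : T -> seq T) (s : #|T|.-tuple T).
Variables (k m c : nat) (recs : seq (T * T * nat)).
Hypotheses (us : uniq s).
Hypothesis q_lt : forall v, q e s m v < c.
Hypotheses (urecs : uniq recs) (recs_sound : {in recs, forall x, sound_rec e s m x}).
Hypothesis recs_complete : forall z v l, wreach e s l z v -> l <= m ->
  exists2 r, (z, v, r) \in recs & m < r + l.

Implicit Types (x : T * T * nat) (v w z a : T) (F : T -> option T).

Let pos v := index v s.

Lemma reach_recs z v :
  wreach e s m z v -> has (fun x => x.1.1 == z) (recs_at v recs).
Proof.
move=> /recs_complete/(_ (leqnn m))[r zr _].
by apply/hasP; exists (z, v, r); rewrite ?mem_filter /= ?eqxx.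
Qed.

Lemma recs_reach x v : x \in recs_at v recs -> wreach e s m x.1.1 v.
Proof. by rewrite mem_filter => /andP[/eqP <- /recs_sound /sound_reach]. Qed.

(** The conditions imposed on [F] for the extraction, when only the vertices at positions below i
    have been treated. *)
Definition claim_inv i F : Prop :=
  [/\ forall z a, F z = Some a -> [/\ F a = Some a, wreach e s m z a & index a s < i],
      forall z a, F a = Some a -> wreach e s m z a ->
        exists2 x, F z = Some x & index x s <= index a s,
      forall l z a, F a = Some a -> wreach e s l z a -> l <= k -> l <= m ->
        F z = Some a &
      forall v, index v s < i ->
        F v = Some v \/ exists2 z, F z != None & wreach e s k z v].

Definition blocks F x : bool := (F x.1.1 != None) && (m < k + x.2).

Definition claim F v (dn : seq (T * T * nat)) z : option T :=
  if F z is Some a then Some a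
  else if has (fun x => x.1.1 == z) dn then Some v else None.

Lemma claim_inv_skip F v :
  claim_inv (pos v) F -> has (blocks F) (recs_at v recs) -> claim_inv (pos v).+1 F.
Proof.
move=> [h1 h2 h3 h4] /hasP[x]; rewrite mem_filter => /andP[/eqP xv xr].
case/andP=> Fx near; split=> //.
  by move=> z a /h1[? ? ?]; split=> //; apply: leq_trans (leqnSn _).
move=> w; rewrite ltnS leq_eqVlt => /predU1P[/(pos_inj us) ->|/h4//].
right; exists x.1.1 => //; have [_] := recs_sound xr; rewrite xv.
by apply: wreachW; lia.
Qed.

Lemma claim_inv_claim F v :
  claim_inv (pos v) F -> ~~ has (blocks F) (recs_at v recs) ->
  claim_inv (pos v).+1 (claim F v (recs_at v recs)).
Proof.
move=> [h1 h2 h3 h4] /hasPn nb; set F' := claim _ _ _.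
have Fmono z a : F z = Some a -> F' z = Some a by rewrite /F' /claim => ->.
(* By completeness such a z has a record with remainder r > m - l, hence k + r > m. Were z already
   claimed, this record would block v. *)
have near l z : wreach e s l z v -> l <= k -> l <= m -> F' z = Some v.
  move=> zv lk lm; have [r zr hr] := recs_complete zv lm.
  have := nb (z, v, r); rewrite mem_filter eqxx zr /blocks /= => /(_ isT).
  rewrite negb_and negbK -leqNgt => /orP[/eqP Fz|]; last by lia.
  rewrite /F' /claim Fz reach_recs //; exact: wreachW zv.
have F'v : F' v = Some v by apply: (near 0) => //; apply: wreach_refl.
have new z a : F' z = Some a -> F z = Some a \/ a = v /\ wreach e s m z v.
  rewrite /F' /claim; case: (F z) => [b|]; first by left.
  by case: hasP => // -[x xr /eqP <-] [<-]; right; split=> //; apply: recs_reach.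
split.
- move=> z a /new[/h1[Fa za lt]|[-> zv]]; last by split.
  by split=> //; [apply: Fmono | apply: leq_trans lt _].
- move=> z a /new[Fa za|[-> _] zv].
    by have [x /Fmono ? ?] := h2 _ _ Fa za; exists x.
  rewrite /F' /claim; case Fz: (F z) => [a'|].
    by have [_ _ /ltnW] := h1 _ _ Fz; exists a'.
  by rewrite reach_recs //; exists v.
- move=> l z a /new[Fa za lk lm|[-> _] //]; last exact: near.
  by apply: Fmono; apply: h3 za lk lm.
move=> w; rewrite ltnS leq_eqVlt => /predU1P[/(pos_inj us) ->|/h4[/Fmono|[z Fz zw]]].
- by left.
- by left.
by right; exists z => //; case Fz': (F z) Fz => [a|//]; rewrite (Fmono _ _ Fz').
Qed.

Let represents := rep adj s k m.

Definition owner F st : Prop :=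
  forall z, cell st 3 (code z) = if F z is Some a then (code a).+1 else 0.

Let quiet st := forall b j, b \in [:: 4; 10] -> cell st b j = 0.

Let L := c * m.+1.

Lemma runs_claim st :
  represents recs st -> (forall b j, b \in [:: 3; 4; 10] -> cell st b j = 0) ->
  runs claim_cmd st (fun st' t => exists F,
    [/\ represents recs st', claim_inv #|T| F, owner F st', reg st' 4 = #|T| &
        quiet st'] /\
    t <= (80 + 60 * L) * #|T| + 10).
Proof.
move=> hrep q0; do 3 run; set st1 := set_reg _ _ _.
have rep1 : represents recs st1 by apply: rep_set_reg.
pose J (g : nat * (T -> option T)) st :=
  [/\ represents recs st, claim_inv g.1 g.2, owner g.2 st,
      reg st 4 = g.1 /\ g.1 <= #|T| & quiet st].
pose Phi (g : nat * (T -> option T)) := (80 + 60 * L) * (#|T| - g.1).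
apply: (runs_conseq (runs_while (I := J) (Phi := Phi) _ (g := (0, fun=> None)) _)).
- move=> [i F] st2 [/= rep2 inv own [h4 ile] q2].
  have [[h0 h1 h2 h3 _] _] := rep2; rewrite h0 h4 => nz.
  have lt_i : i < #|T| by lia.
  have [v vi] := pos_surj us lt_i.
  have szL : size (recs_at v recs) <= L by apply: (size_recs_at us q_lt).
  do 5 run; rewrite h4 -vi h3; set st3 := set_reg _ _ _.
  have rep3 : represents recs st3 by do 2 apply: rep_set_reg => //.
  pose I1 dn st := [/\ owner F st, reg st 9 = ~~ has (blocks F) dn,
                       reg st 4 = i & quiet st].
  apply: (runs_conseq (@runs_each_rec _ adj s k m recs v _ I1 20 st3 _ _ _ _ _)) => //.
  + move=> dn x st4 xr xv rep4 h54 [own4 h94 h44 q4] c7 c8.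
    have [[_ h14 h24 _ _] _] := rep4.
    have keep : ~~ blocks F x -> I1 (x :: dn) st4.
      by move=> /negPf nb; split; rewrite //= nb.
    apply: runs_if => /=; rewrite c7 own4 => Fx; last first.
      run; split=> //; apply: keep; rewrite /blocks.
      by case: (F x.1.1) Fx.
    apply: runs_if => /=; rewrite h14 h24 c8 => near; run; split=> //.
    * split=> //=; suff -> : blocks F x by [].
      by rewrite /blocks -subn_gt0 lt0n near andbT; case: (F x.1.1) Fx.
    * by apply: keep; rewrite /blocks -subn_gt0 lt0n near andbF.
  move=> st4 t4 [rep4 h54 [own4 h94 h44 q4] ht4].
  run; apply: runs_if => /=; rewrite h94 => test.
    have nb : ~~ has (blocks F) (recs_at v recs) by move: test; case: has.
    pose I2 dn st := [/\ owner (claim F v dn) st, reg st 4 = i & quiet st].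
    apply: (runs_conseq (@runs_each_rec _ adj s k m recs v _ I2 20 st4 _ _ _ _ _)) => //.
    + move=> dn x st5 xr xv rep5 h55 [own5 h45 q5] c7 c8.
      (* Several records at v may share a source; at most the first one visited changes the
         owner. *)
      have upd z : claim F v (x :: dn) z =
          if (z == x.1.1) && (claim F v dn z == None) then Some v else claim F v dn z.
        rewrite /claim /= eq_sym; case: (F z) => [a|]; first by rewrite andbF.
        by case: eqVneq => //= _; case: has.
      apply: runs_if => /=; rewrite c7 own5 => Fx.
        run; split=> //; split=> // z; rewrite own5 upd.
        case: eqVneq => //= ->; by case: (claim _ _ _ _) Fx.
      run; split=> //.
      split=> //=; last by move=> b j hb /=; move: (q5 b j hb); rewrite !inE in hb *; case/orP: hb => /eqP ->.
      move=> z /=; rewrite upd c7 eq_code h55 addn1; case: eqVneq => //= ->.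
      by case: (claim _ _ _ _) Fx.
    + by split=> // z; rewrite own4 /claim; case: (F z).
    move=> st5 t5 [rep5 h55 [own5 h45 q5] ht5]; do 3 run.
    exists ((pos v).+1, claim F v (recs_at v recs)).
      split=> //=; last by rewrite /pos vi h45 addn1.
      * by apply: claim_inv_claim; rewrite /pos ?vi.
    rewrite /Phi /= /pos vi.
    have -> : #|T| - i = (#|T| - i.+1).+1 by lia.
    by rewrite mulnS; move: (_ * (_ - _)) => X; lia.
  have bl : has (blocks F) (recs_at v recs) by move: test; case: has.
  do 4 run; exists ((pos v).+1, F).
    split=> //=; last by rewrite /pos vi h44 addn1.
    * by apply: claim_inv_skip; rewrite /pos ?vi.
  rewrite /Phi /= /pos vi.
  have -> : #|T| - i = (#|T| - i.+1).+1 by lia.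
  by rewrite mulnS; move: (_ * (_ - _)) => X; lia.
- split=> //=.
    by move=> z /=; rewrite q0.
  by move=> b j hb; rewrite /= q0 // inE hb orbT.
move=> st2 t2 [[i F] [/= [rep2 inv own [h4 ile] q2] e0 ht]].
have [[h0 _ _ _ _] _] := rep2; rewrite h0 h4 in e0.
have iT : i = #|T| by apply/eqP; rewrite eqn_leq ile -subn_eq0 e0.
run; exists F; rewrite -iT; split=> //.
by move: ht; rewrite /Phi iT subnn muln0 subn0 /=; lia.
Qed.

(** [M] is the set of marked centres. It contains the kept ones too, as each of them owns itself and
    reaches itself. *)
Definition select_inv F i (A M : {set T}) : Prop :=
  [/\ forall a, a \in A -> F a = Some a /\ i <= index a s,
      forall a b z, a \in A -> b \in A -> index a s < index b s ->
        wreach e s m z b -> F z <> Some a,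
      forall a, (a \in M) <->
        (exists b z, [/\ b \in A, wreach e s m z b & F z = Some a]) &
      forall a, F a = Some a -> i <= index a s ->
        exists b z, [/\ b \in A, wreach e s m z b & F z = Some a]].

Lemma select_inv_skip F v A M :
  select_inv F (pos v).+1 A M -> F v <> Some v \/ v \in M ->
  select_inv F (pos v) A M.
Proof.
move=> [h1 h2 h3 h4] hv; split=> //.
  by move=> a /h1[? /ltnW].
move=> a Fa; rewrite leq_eqVlt => /predU1P[/(pos_inj us) va|]; last exact: h4.
by rewrite -va in Fa *; case: hv => [//|/h3].
Qed.

Lemma select_inv_add F v A M :
  select_inv F (pos v).+1 A M -> F v = Some v -> v \notin M ->
  select_inv F (pos v) (v |: A)
    (M :|: [set a | has (fun x => F x.1.1 == Some a) (recs_at v recs)]).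
Proof.
move=> [h1 h2 h3 h4] Fv vM.
have mark a : has (fun x => F x.1.1 == Some a) (recs_at v recs) <->
    exists2 z, wreach e s m z v & F z = Some a.
  split=> [/hasP[x /recs_reach xv /eqP Fx]|[z zv Fz]]; first by exists x.1.1.
  have /hasP[x xr /eqP xz] := reach_recs zv.
  by apply/hasP; exists x; rewrite // xz Fz.
split.
- by move=> a /setU1P[->|/h1[? /ltnW]].
- move=> a b z /setU1P[->|aA] /setU1P[->|bA]; last exact: h2.
  + by rewrite ltnn.
  + by move=> _ zb Fz; case/negP: vM; apply/h3; exists b, z.
  by have [_ lt] := h1 _ aA; rewrite ltnNge ltnW.
- move=> a; rewrite inE inE; split.
    case/orP=> [/h3[b [z [bA zb Fz]]]|/mark[z zv Fz]].
      by exists b, z; rewrite setU1r.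
    by exists v, z; rewrite setU11.
  move=> [b [z [/setU1P[->|bA] zb Fz]]].
    by apply/orP; right; apply/mark; exists z.
  by apply/orP; left; apply/h3; exists b, z.
move=> a Fa; rewrite leq_eqVlt => /predU1P[/(pos_inj us) <-|lt].
  by exists v, v; rewrite setU11; split=> //; apply: wreach_refl.
by have [b [z [bA zb Fz]]] := h4 a Fa lt; exists b, z; rewrite setU1r.
Qed.

Lemma runs_select F st :
  represents recs st -> claim_inv #|T| F -> owner F st -> reg st 4 = #|T| ->
  quiet st ->
  runs select_cmd st (fun st' t => exists A M,
    [/\ select_inv F 0 A M, owner F st',
        forall v, cell st' 4 (code v) = (v \in A) &
        t <= (80 + 20 * L) * #|T| + 10]).
Proof.
move=> hrep [_ F_claimed _ _] own h4 hq.
pose marked (M : {set T}) st := forall v, cell st 10 (code v).+1 = (v \in M).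
pose chosen (A : {set T}) st := forall v, cell st 4 (code v) = (v \in A).
pose J (g : nat * {set T} * {set T}) st :=
  [/\ represents recs st, select_inv F g.1.1 g.1.2 g.2, owner F st,
      reg st 4 = g.1.1 /\ g.1.1 <= #|T| & chosen g.1.2 st /\ marked g.2 st].
pose Phi (g : nat * {set T} * {set T}) := (80 + 20 * L) * g.1.1.
apply: (runs_conseq (runs_while (I := J) (Phi := Phi) _ (g := (#|T|, set0, set0)) _)).
- move=> [[[|i] A] M] st1 [/= rep1 inv own1 [h41 ile] [ch1 mk1]]; rewrite h41 => // _.
  have [v vi] := pos_surj us ile.
  have szL : size (recs_at v recs) <= L by apply: (size_recs_at us q_lt).
  have [[_ _ _ h0 _] _] := rep1.
  rewrite -vi in inv.
  do 5 run; rewrite h41 subn1 /= -vi h0; set st2 := set_reg _ _ _.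
  have rep2 : represents recs st2 by do 2 apply: rep_set_reg => //.
  apply: runs_if => /=; rewrite own1 !addn1 mk1 => test.
    do 2 run; exists (pos v, A, M); last by rewrite /Phi /= -/pos mulnS; move: (_ * _) => X; lia.
    split=> //=; last by rewrite /pos vi; split=> //; apply: ltnW.
    apply: select_inv_skip => //.
    case Fv: (F v) test => [a|]; last by left.
    case: (v \in M) => [|test]; first by right.
    by left=> -[av]; move: test; rewrite av subnn.
  have vM : v \notin M by move: test; case: (v \in M) => //; lia.
  have Fv : F v = Some v.
    case: (F v) test => [a|] test; last by lia.
    by congr Some; apply: code_inj; lia.
  do 2 run; set st3 := set_mem _ _ _ _.
  have rep3 : represents recs st3 by apply: rep_set_mem rep2.
  pose I dn st := [/\ owner F st, reg st 4 = i, chosen (v |: A) st &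
    marked (M :|: [set a | has (fun x => F x.1.1 == Some a) dn]) st].
  apply: (runs_conseq (@runs_each_rec _ adj s k m recs v _ I 10 st3 _ _ _ _ _)) => //.
  + move=> dn x st4 xr xv rep4 h54 [own4 h44 ch4 mk4] c7 c8.
    have xz : wreach e s m x.1.1 v.
      by apply: recs_reach; rewrite mem_filter xr xv eqxx.
    (* Every vertex reaching the centre v is claimed, so the marked address is never the 0 of
       unclaimed vertices. *)
    have [a Fx _] := F_claimed _ _ Fv xz.
    run; split=> //; split=> // u /=.
    rewrite c7 own4 Fx eqSS eq_code mk4 !inE /=.
    by rewrite -[Some a == _]/(a == u) eq_sym; case: eqVneq => //=; rewrite orbT.
  + split=> //=.
      by move=> u /=; rewrite eq_code !inE ch1; case: eqVneq.
    by move=> u /=; rewrite mk1 !inE orbF.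
  move=> st4 t4 [rep4 h54 [own4 h44 ch4 mk4] ht4].
  run; exists (pos v, v |: A,
    M :|: [set a | has (fun x => F x.1.1 == Some a) (recs_at v recs)]).
    split=> //=; first exact: select_inv_add.
    by rewrite /pos vi; split=> //; apply: ltnW.
  by rewrite /Phi /= -/pos mulnS; move: (_ * pos v) => X; lia.
- split=> //=.
  + split=> [a|a b z|a|a Fa]; rewrite ?inE //.
      by split=> // -[b [z []]]; rewrite inE.
    by rewrite leqNgt pos_lt.
  + by split=> v; rewrite ?inE; apply: hq.
move=> st1 t1 [[[i A] M] [/= [rep1 inv own1 [h41 ile] [ch1 _]] e0 ht]].
have i0 : i = 0 by move: h41; rewrite e0.
rewrite i0 in inv; exists A, M; split=> //.
by move: ht; rewrite /Phi /=; lia.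
Qed.

End Claim.

(** * Total running time, correctness of the program, and the theorem *)

Lemma total_cost_leq n k m c : 0 < m -> 0 < c ->
  60 * n + 100 * (c * m.+1 * (2 * c * n)) + 20 +
    ((80 + 60 * (c * m.+1)) * n + 10 + ((80 + 20 * (c * m.+1)) * n + 10))
  <= 820 * maxn 1 (c ^ 2 * maxn k m * n).
Proof.
move=> m_gt0 c_gt0; rewrite -mulnn; set M := maxn k m; set X := _ * M * n.
have mM : m.+1 <= 2 * M by rewrite /M; lia.
have M_gt0 : 0 < M by lia.
have h0 : n <= X by rewrite /X -[leqLHS]mul1n leq_mul2r !muln_gt0 c_gt0 M_gt0 orbT.
have h1 : c * m.+1 * n <= 2 * X.
  have -> : 2 * X = c * c * (2 * M) * n by rewrite /X; lia.
  by rewrite leq_mul2r leq_mul ?orbT // leq_pmulr.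
have h2 : c * m.+1 * (2 * c * n) <= 4 * X.
  have -> : c * m.+1 * (2 * c * n) = 2 * (c * c * m.+1 * n) by lia.
  have -> : 4 * X = 2 * (c * c * (2 * M) * n) by rewrite /X; lia.
  by rewrite leq_mul2l leq_mul2r leq_mul2l mM !orbT.
(* The summands give (60 + 400 + 80 + 120 + 80 + 40) X + 40 = 780 X + 40, which is at most 820 times
   the maximum of 1 and X. *)
move: h0 h1 h2; move: X (c * m.+1) (2 * c * n) => X L B; lia.
Qed.

Lemma main_cmd_correct (T : finType) (e : rel T) (k m c : nat)
    (adj : T -> seq T) (s : #|T|.-tuple T) :
  symmetric e -> irreflexive e -> 1 <= m <= 2 * k + 1 -> 1 <= c ->
  adjacency_lists e adj -> uniq s -> (forall v : T, q e s m v < c) ->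
  exists (st : state) (t : nat),
    [/\ exec main_cmd (input adj s k m c) st t,
        t <= 820 * maxn 1 (c ^ 2 * maxn k m * #|T|),
        dominating e k (output T 3 st),
        independent e m (output T 4 st) &
        #|output T 3 st| <= c ^ 2 * #|output T 4 st|].
Proof.
move=> esym irr /andP[m_gt0 m_le] c_gt0 hadj us q_lt.
suff [st [t [ex h]]] : runs main_cmd (input adj s k m c) (fun st t =>
    [/\ t <= 820 * maxn 1 (c ^ 2 * maxn k m * #|T|),
        dominating e k (output T 3 st),
        independent e m (output T 4 st) &
        #|output T 3 st| <= c ^ 2 * #|output T 4 st|]).
  by exists st, t; case: h.
apply: runs_seq.
apply: runs_conseq (runs_search k esym irr us m_gt0 hadj q_lt) _.
move=> st1 t1 [recs [[rep1 q1 ur snd] [compl ht1]]].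
apply: runs_seq; apply: runs_conseq (runs_claim us q_lt ur snd compl rep1 q1) _.
move=> st2 t2 [F [[rep2 inv own h4 q2] ht2]].
apply: runs_conseq (runs_select us q_lt ur snd compl rep2 inv own h4 q2) _.
move=> st3 t3 [A [M [sel own3 ch3 ht3]]].
have [F1 F2 F3 F4] := inv; have [A1 A2 _ A4] := sel.
have -> : output T 3 st3 = [set z | F z != None].
  by apply/setP => z; rewrite !inE own3; case: (F z).
have -> : output T 4 st3 = A.
  by apply/setP => z; rewrite inE ch3; case: (z \in A).
have F_dom v : F v = Some v \/ exists2 z, F z != None & wreach e s k z v.
  by apply: F4; apply: pos_lt.
split.
- apply: leq_trans (total_cost_leq #|T| k m_gt0 c_gt0).
  by rewrite leq_add // leq_add.
- exact: extract_dominating F_dom.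
- apply: (extract_independent esym us m_le F2 F3) => [b /A1[]|] //.
- apply: (extract_card us q_lt (F := F)) => [z a /F1[]|a Fa] //.
  exact: A4.
Qed.

Theorem theorem4 :
  (forall (T : finType) (e : rel T) (k m c : nat),
     symmetric e -> irreflexive e ->
     1 <= m <= 2 * k + 1 -> 1 <= c ->
     wcol e m <= c -> dom e k <= c ^ 2 * alpha e m)
  /\
  (exists (P : cmd) (C : nat),
     forall (T : finType) (e : rel T) (k m c : nat)
            (adj : T -> seq T) (s : #|T|.-tuple T),
       symmetric e -> irreflexive e ->
       1 <= m <= 2 * k + 1 -> 1 <= c ->
       adjacency_lists e adj ->
       uniq s -> (forall v : T, q e s m v < c) ->
       exists (st : state) (t : nat),
         [/\ exec P (input adj s k m c) st t,
             t <= C * maxn 1 (c ^ 2 * maxn k m * #|T|),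
             dominating e k (output T 3 st),
             independent e m (output T 4 st) &
             #|output T 3 st| <= c ^ 2 * #|output T 4 st|]).
Proof.
split; last first.
  by exists main_cmd, 820 => T e k m c adj s; apply: main_cmd_correct.
(* The inequality is read off from the output of the program on an optimal ordering. *)
move=> T e k m c esym irr hm c_gt0; rewrite /wcol.
case: arg_minnP => [|s us _ wc]; first exact: enum_uniq.
have hadj : adjacency_lists e (fun v => enum (e v)).
  by move=> v; split; [apply: enum_uniq | move=> w; rewrite mem_enum].
have q_lt v : q e s m v < c.
  by apply: leq_trans wc; rewrite -add1n; apply: (leq_bigmax v).
have [st [t [_ _ hD hA hc]]] := main_cmd_correct esym irr hm c_gt0 hadj us q_lt.
rewrite /dom; case: arg_minnP => [|D _ minD].
  apply/forallP => v; apply/existsP; exists v; rewrite inE /=.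
  exact: (wreach_dist esym (wreach_refl e s k v)).
apply: leq_trans (minD _ hD) _; apply: leq_trans hc _.
by rewrite leq_mul2l; apply/orP; right; apply: (leq_bigmax_cond (F := fun A : {set T} => #|A|)).
Qed.
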